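(* Let $a,b$ be nonnegative integers and let $p=(10a+7)(10b+3)$. Put $A=a+1$ and $B=b+1$. Then: (1) if $4\le A\le \dfrac{\sqrt{p}+3}{10}$, then $$1\le \frac{p+70A-21}{p+259}\le e^{(7\sqrt{p}-259)/p};$$ (2) if $8\le B\le \dfrac{\sqrt{p}+7}{10}$, then $$1\le \frac{p+30B-21}{p+219}\le e^{(3\sqrt{p}-3)/p}.$$ *)

(* Defs.v *)
From Stdlib Require Export Reals.

(* Main.v *)
(** With [s = sqrt p], the upper bound on [A] reads [70 A - 21 <= 7 s] and the
    upper bound on [B] reads [30 B - 21 <= 3 s], so both parts are instances of
    [(p + x) / (p + c) = 1 + (x - c) / (p + c) <= 1 + (x - c) / p <= exp ((x - c) / p)]
    for [0 <= c <= x].  The lower bounds on [A] and [B] are exactly [c <= x]. *)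
Require Import Defs.
From Stdlib Require Import Reals Lra Lia.
Open Scope R_scope.

(** A free [y] above [x - c] is allowed because the two exponents are not equally tight. *)
Lemma shifted_ratio_exp_bounds (q c x y : R) :
  0 < q -> 0 <= c <= x -> x - c <= y ->
  1 <= (q + x) / (q + c) <= exp (y / q).
Proof.
intros Hq [Hc Hx] Hy.
replace ((q + x) / (q + c)) with (1 + (x - c) * / (q + c)) by (field; lra).
assert (Hinv : 0 < / (q + c)) by (apply Rinv_0_lt_compat; lra).
assert (Hle : / (q + c) <= / q) by (apply Rinv_le_contravar; lra).
(* Both factors grow at once, which is sound because [c <= x] makes [x - c] nonnegative. *)
assert (Hbound : (x - c) * / (q + c) <= y / q)
  by (apply Rmult_le_compat; lra).
split.
- assert (0 <= (x - c) * / (q + c)) by (apply Rmult_le_pos; lra). lra.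
- pose proof (exp_ineq1_le (y / q)). lra.
Qed.

Theorem theorem4 (a b p A B : nat)
  (hp : p = ((10 * a + 7) * (10 * b + 3))%nat)
  (hA : A = (a + 1)%nat)
  (hB : B = (b + 1)%nat) :
  (4 <= INR A <= (sqrt (INR p) + 3) / 10 ->
     1 <= (INR p + 70 * INR A - 21) / (INR p + 259)
       <= exp ((7 * sqrt (INR p) - 259) / INR p))
  /\
  (8 <= INR B <= (sqrt (INR p) + 7) / 10 ->
     1 <= (INR p + 30 * INR B - 21) / (INR p + 219)
       <= exp ((3 * sqrt (INR p) - 3) / INR p)).
Proof.
assert (Hp : 0 < INR p) by (apply lt_0_INR; nia).
split; intros [Hlow Hup].
- replace (INR p + 70 * INR A - 21) with (INR p + (70 * INR A - 21)) by ring.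
  apply shifted_ratio_exp_bounds; lra.
- replace (INR p + 30 * INR B - 21) with (INR p + (30 * INR B - 21)) by ring.
  (* Here [c = 219], and the bound on [B] gives [x - c <= 3 s - 219], which lies below the required
     [y = 3 s - 3] with 216 to spare; for [A] the match is exact. *)
  apply shifted_ratio_exp_bounds; lra.
Qed.
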